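(* Let $R$ be a commutative multiplicative hyperring with identity $1$, let $S$ be an n-multiplicatively closed subset of $R$, and let $K$ be a hyperideal of $R$ disjoint from $S$. Then there exists a hyperideal $I$ which is maximal (with respect to inclusion) in the set of all hyperideals of $R$ that are disjoint from $S$ and contain $K$. Any such hyperideal $I$ is an n-hyperideal of $R$.
   Context: A multiplicative hyperring is a nonempty set $R$ with an operation $+$ and a hyperoperation $\circ:R\times R\to P^*(R)$ (where $P^*(R)$ is the set of nonempty subsets of $R$) such that $(R,+)$ is an abelian group; $\circ$ is associative; $a\circ(b+c)\subseteq a\circ b+a\circ c$ and $(b+c)\circ a\subseteq b\circ a+c\circ a$; and $a\circ(-b)=(-a)\circ b=-(a\circ b)$, for all $a,b,c\in R$. For nonempty $A,B\subseteq R$, $A\circ B=\bigcup_{a\in A,b\in B}a\circ b$, $A+B=\{a+b: a\in A,b\in B\}$, $-A=\{-a:a\in A\}$, and elements are identified with singletons in products. $R$ is commutative if $a\circ b=b\circ a$ for all $a,b$; an identity is an element $1$ with $a\in a\circ 1$ for all $a\in R$. A hyperideal is a nonempty $I\subseteq R$ with $a-b\in I$ for $a,b\in I$ and $r\circ x\subseteq I$ for $x\in I$, $r\in R$. Let $\mathbf{C}$ be the class of all finite products $r_1\circ\cdots\circ r_n$ ($r_i\in R$, $n\in\mathbb{N}$); a hyperideal $I$ is a $\mathbf{C}$-hyperideal if for every $A\in\mathbf{C}$, $A\cap I\neq\varnothing$ implies $A\subseteq I$. Standing assumption: all hyperideals are $\mathbf{C}$-hyperideals. A prime hyperideal is a proper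 hyperideal $P$ such that $x\circ y\subseteq P$ implies $x\in P$ or $y\in P$. The prime radical $r(I)$ of a hyperideal $I$ is the intersection of all prime hyperideals containing $I$ (and $r(I)=R$ if there are none); $r(0)$ is the prime radical of the zero hyperideal $\{0\}$. A proper hyperideal $I$ is an n-hyperideal if for all $x,y\in R$, $x\circ y\subseteq I$ and $x\notin r(0)$ imply $y\in I$. A nonempty subset $S$ of $R$ with $R\setminus r(0)\subseteq S$ is n-multiplicatively closed if $a\circ b\subseteq S$ for all $a\in R\setminus r(0)$ and all $b\in S$. *)

(* Defs.v *)
From HB Require Import structures.
From mathcomp Require Import all_boot all_algebra.
From mathcomp Require Import boolp classical_sets.

Set Implicit Arguments.
Unset Strict Implicit.
Unset Printing Implicit Defensive.

Import GRing.Theory.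
Local Open Scope classical_set_scope.
Local Open Scope ring_scope.

Definition set_hmul (T : Type) (op : T -> T -> set T) (A B : set T) : set T :=
  \bigcup_(a in A) \bigcup_(b in B) op a b.

Definition set_add (V : zmodType) (A B : set V) : set V :=
  [set a + b | a in A & b in B].

Definition set_opp (V : zmodType) (A : set V) : set V := [set - a | a in A].

(* [hmul a b] is the hyperproduct of a and b. *)
HB.mixin Record isMultHyperring R of GRing.Zmodule R := {
  hmul : R -> R -> set R;
  hmul_neq0 : forall a b, hmul a b !=set0;
  hmulA : forall a b c,
    set_hmul hmul [set a] (hmul b c) = set_hmul hmul (hmul a b) [set c];
  hmulDr_sub : forall a b c,
    hmul a (b + c) `<=` set_add (hmul a b) (hmul a c);
  hmulDl_sub : forall a b c,
    hmul (b + c) a `<=` set_add (hmul b a) (hmul c a);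
  hmulrN : forall a b, hmul a (- b) = set_opp (hmul a b);
  hmulNr : forall a b, hmul (- a) b = set_opp (hmul a b)
}.

#[short(type="multHyperringType")]
HB.structure Definition MultHyperring :=
  {R of isMultHyperring R & GRing.Zmodule R}.

HB.mixin Record MultHyperring_isCommutative R of MultHyperring R := {
  hmulC : forall a b : R, hmul a b = hmul b a
}.

#[short(type="comMultHyperringType")]
HB.structure Definition ComMultHyperring :=
  {R of MultHyperring_isCommutative R & MultHyperring R}.

Section MultHyperringTheory.
Variable R : multHyperringType.
Implicit Types (A I K P S : set R) (F : set (set R)).

Definition hyper_identity (e : R) : Prop := forall a : R, hmul a e a.

(* The finite product r o s_1 o ... o s_k; the head r keeps products
   nonempty, and the product of a single element is its singleton. *)
Definition hprod (r : R) (s : seq R) : set R :=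
  foldl (fun A x => set_hmul hmul A [set x]) [set r] s.

Definition hyperideal I : Prop :=
  [/\ I !=set0,
      forall a b, I a -> I b -> I (a - b)
    & forall r x, I x -> hmul r x `<=` I].

Definition C_hyperideal I : Prop :=
  hyperideal I /\
  forall (r : R) (s : seq R), hprod r s `&` I !=set0 -> hprod r s `<=` I.

(* By the standing convention every hyperideal considered is a C-hyperideal,
   so from here on [C_hyperideal] stands wherever the mathematics says
   "hyperideal".  If all hyperideals of R happen to be C-hyperideals, the two
   predicates agree. *)

Definition prime_hyperideal P : Prop :=
  [/\ C_hyperideal P, P <> setT
    & forall x y, hmul x y `<=` P -> P x \/ P y].

(* When no prime hyperideal contains I, this is an empty intersection, setT. *)
Definition prime_radical I : set R :=
  \bigcap_(P in [set P | prime_hyperideal P /\ I `<=` P]) P.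

Definition nilradical : set R := prime_radical [set 0].

Definition n_hyperideal I : Prop :=
  [/\ C_hyperideal I, I <> setT
    & forall x y, hmul x y `<=` I -> ~ nilradical x -> I y].

Definition n_mult_closed S : Prop :=
  [/\ S !=set0, ~` nilradical `<=` S
    & forall a b, ~ nilradical a -> S b -> hmul a b `<=` S].

Definition hyperideals_avoiding S K : set (set R) :=
  [set I | [/\ C_hyperideal I, I `&` S = set0 & K `<=` I]].

Definition maximal_in F I : Prop :=
  F I /\ forall J, F J -> I `<=` J -> J = I.

End MultHyperringTheory.

Arguments nilradical : clear implicits.

(* Main.v *)
Require Import Defs.
From mathcomp Require Import all_boot all_algebra.
From mathcomp Require Import boolp classical_sets.

Set Implicit Arguments.
Unset Strict Implicit.
Unset Printing Implicit Defensive.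

Local Open Scope classical_set_scope.

(** Existence is Zorn's lemma ([exists_maximal_above]): the three conditions
    defining a C-hyperideal, disjointness from [S] and containment of [K] all
    pass to the union of a nonempty chain ([C_hyperideal_bigcup]).

    For the second half, let [I] be maximal, [x o y] contained in [I], and [x]
    outside the nilradical.  The residual [(I : x)] is again a C-hyperideal
    ([C_hyperideal_residual]) and contains [I].  It is disjoint from [S]: if
    [s] lay in both, the nonempty set [s o x] would lie in [I], but also in
    [S] because [S] absorbs products with [x].  Maximality then forces
    [(I : x) = I], and [y] belongs to the left-hand side. *)

(** Zorn's lemma for unions of chains also asks about the empty chain, whose
    union need not lie in [F].  Applying it to the sets [A] such that
    [A `|` K] is in [F] repairs this: the empty chain then corresponds to
    [K]. *)
Lemma exists_maximal_above (T : Type) (F : set (set T)) (K : set T) :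
  F K -> (forall A, F A -> K `<=` A) ->
  (forall G, G !=set0 -> G `<=` F -> total_on G subset ->
     F (\bigcup_(A in G) A)) ->
  exists I, F I /\ forall J, F J -> I `<=` J -> J = I.
Proof.
move=> FK KF chainF.
have [|A [FA Amax]] := @Zorn_bigcup T [set A | F (A `|` K)].
  move=> G GF Gtot /=.
  have [[B GB]|G0] := pselect (G !=set0); last first.
    suff -> : \bigcup_(X in G) X = set0 by rewrite set0U.
    by apply/seteqP; split=> // x [X GX _]; apply: G0; exists X.
  have -> : \bigcup_(X in G) X `|` K
          = \bigcup_(X in [set X `|` K | X in G]) X.
    apply/seteqP; split=> x.
      case=> [[X GX Xx]|Kx].
        by exists (X `|` K); [exists X | left].
      by exists (B `|` K); [exists B | right].
    by case=> _ [X GX <-] [Xx|Kx]; [left; exists X | right].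
  apply: chainF.
  - by exists (B `|` K), B.
  - by move=> _ [X GX <-]; exact: GF.
  - move=> _ _ [X GX <-] [Y GY <-].
    by have [XY|YX] := Gtot X Y GX GY; [left|right]; exact: setSU.
exists (A `|` K); split=> // J FJ AKJ.
apply/seteqP; split=> //.
have [AJ|nAJ] := pselect (J `<=` A).
  by move=> x /AJ; left.
exfalso; apply: (Amax J); last first.
  by rewrite /= (setUidl (KF _ FJ)).
by split=> // x Ax; apply: AKJ; left.
Qed.

(** Each closure condition starts from at most two elements of the union, and
    a chain places them in a common member. *)
Lemma C_hyperideal_bigcup (R : multHyperringType) (G : set (set R)) :
  G !=set0 -> total_on G subset -> (forall A, G A -> C_hyperideal A) ->
  C_hyperideal (\bigcup_(A in G) A).
Proof.
move=> [B GB] Gtot GC; split; first split.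
- by have [[[b Bb] _ _] _] := GC B GB; exists b, B.
- move=> a b [X GX Xa] [Y GY Yb].
  have [XY|YX] := Gtot X Y GX GY.
    by exists Y => //; have [[_ + _] _] := GC Y GY; apply=> //; exact: XY.
  by exists X => //; have [[_ + _] _] := GC X GX; apply=> //; exact: YX.
- move=> r x [X GX Xx] z rxz; exists X => //.
  by have [[_ _ Xmul] _] := GC X GX; exact: Xmul rxz.
- move=> r s [t [rst [X GX Xt]]] z rsz; exists X => //.
  by have [_ XC] := GC X GX; apply: (XC r s) => //; exists t.
Qed.

Definition residual (R : multHyperringType) (I : set R) (x : R) : set R :=
  [set a | hmul a x `<=` I].

Lemma sub_residual (R : comMultHyperringType) (I : set R) (x : R) :
  hyperideal I -> I `<=` residual I x.
Proof. by move=> [_ _ Imul] a Ia; rewrite /residual /= hmulC; exact: Imul. Qed.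

(** The C-condition transfers from [I] because [A o x] is a finite product
    whenever [A] is: if some [t] in [A] has [t o x] inside [I], then [A o x]
    meets [I] ([t o x] being nonempty), so all of [A o x] lies in [I]. *)
Lemma C_hyperideal_residual (R : comMultHyperringType) (I : set R) (x : R) :
  C_hyperideal I -> C_hyperideal (residual I x).
Proof.
move=> [hI IC]; have [[i Ii] Isub Imul] := hI; split; first split.
- by exists i; exact: sub_residual.
- move=> a b ax bx z /hmulDl_sub [u au [v]].
  rewrite hmulNr => -[w bw <-] <-.
  by apply: Isub; [exact: ax | exact: bx].
- move=> r a ax t rat z txz.
  have : set_hmul hmul (hmul r a) [set x] z by exists t => //; exists x.
  by rewrite -hmulA => -[_ -> [u axu ruz]]; exact: Imul (ax _ axu) _ ruz.
- move=> r s [t [rst tx]] u rsu z uxz.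
  have mem_hprod v w : hprod r s v -> hmul v x w -> hprod r (rcons s x) w.
    move=> rsv vxw; rewrite /hprod foldl_rcons.
    by exists v => //; exists x.
  have [w txw] := hmul_neq0 t x.
  apply: (IC r (rcons s x)); last exact: mem_hprod uxz.
  by exists w; split; [exact: mem_hprod txw | exact: tx].
Qed.

Theorem theorem5p11 (R : comMultHyperringType) (e : R)
    (he : hyper_identity e) (S K : set R)
    (hS : n_mult_closed S) (hK : C_hyperideal K) (hKS : K `&` S = set0) :
  (exists I : set R, maximal_in (hyperideals_avoiding S K) I) /\
  (forall I : set R, maximal_in (hyperideals_avoiding S K) I ->
     n_hyperideal I).
Proof.
have [[s0 Ss0] _ Smul] := hS; split.
  apply: (@exists_maximal_above _ (hyperideals_avoiding S K) K).
  - by split.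
  - by move=> A [].
  - move=> G [B GB] GF Gtot; split.
    + by apply: C_hyperideal_bigcup => //; [exists B | move=> A /GF []].
    + by rewrite setI_bigcupl; apply: bigcup0 => A /GF [].
    + by have [_ _ KB] := GF B GB; move=> k /KB; exists B.
move=> I [[hI IS KI] Imax]; split=> //.
  by move=> IT; move: IS Ss0; rewrite IT setTI => ->.
move=> x y xyI nx.
have subI : I `<=` residual I x by apply: sub_residual; case: hI.
suff <- : residual I x = I by rewrite /residual /= hmulC.
apply: Imax => //; split.
- exact: C_hyperideal_residual.
- apply/seteqP; split=> // s [sx Ss].
  have [z sxz] := hmul_neq0 s x.
  have : (I `&` S) z.
    by split; [exact: sx | apply: (Smul x s) => //; rewrite hmulC].
  by rewrite IS.
- exact: subset_trans KI subI.
Qed.
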